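(* Let $\varepsilon \in \left(0,\frac12-e^{-1}\right)$. Then there exists $n_\varepsilon\in\mathbb{N}$ such that for all $n\ge n_\varepsilon$, $$\mathbb{P}\left[\left\{\mathbf{b}\in\mathcal{M}_n : \mathcal{A}_n(\mathbf{b})\text{ synchronizes}\right\}\right] \ge 1 - \left\lfloor\tfrac n2\right\rfloor \exp\left\{-\frac{1}{2n}\left(\varepsilon\left\lfloor\tfrac n2\right\rfloor-1\right)^2\right\} - \frac{\mathbb{V}[D]}{\left(\varepsilon\left\lfloor\tfrac n2\right\rfloor-1\right)^2},$$ where $\mathbb{V}[D]$, the variance of the random variable $D$ on $\mathcal{M}_n$, is given by $$\mathbb{V}[D]=\sum_{i=1}^{\lfloor n/2\rfloor}\left(\frac{P_i(n)}{n^n}-\frac{P_i(n)^2}{n^{2n}}\right)+2\sum_{1\le i<j\le\lfloor n/2\rfloor}\left(\frac{P_{i,j}(n)}{n^n}-\frac{P_i(n)P_j(n)}{n^{2n}}\right).$$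
   Context: For a positive integer $n$ let $\mathbb{Z}_n := \{0,1,\ldots,n-1\}$ and $(r)_n := r \bmod n \in \mathbb{Z}_n$. For $r\in\mathbb{Z}$, $|r|_n := \min\{(r)_n,(-r)_n\}\in\{0,1,\ldots,\lfloor n/2\rfloor\}$. $\mathcal{M}_n$ is the set of all mappings $\mathbf{b}:\mathbb{Z}_n\to\mathbb{Z}_n$, written as vectors $\mathbf{b}=(b_0,\ldots,b_{n-1})$ with $b_i=\mathbf{b}(i)$; $\mathbb{P}$ is the uniform probability measure on $\mathcal{M}_n$, and variance is taken with respect to $\mathbb{P}$. A complete deterministic finite automaton is a pair $(Q,L)$, where $Q$ is a finite set of states and $L$ is a finite set of mappings $Q\to Q$ (letters). Words over $L$ act on $Q$ by applying their letters successively. The automaton synchronizes if there is a word over $L$ acting on $Q$ as a constant mapping. $\mathcal{A}_n(\mathbf{b}) := (\mathbb{Z}_n,\{\mathbf{a},\mathbf{b}\})$, where $\mathbf{a}(i)=(i+1)_n$ and $\mathbf{b}\in\mathcal{M}_n$. For $1\le i\le\lfloor n/2\rfloor$ let $D_i(\mathbf{b})=1$ if there exist $k,l\in\mathbb{Z}_n$ with $|k-l|_n=i$ and $|b_k-b_l|_n=0$ (that is, $b_k=b_l$), and $D_i(\mathbf{b})=0$ otherwise; let $D(\mathbf{b}):=\sum_{i=1}^{\lfloor n/2\rfloor}D_i(\mathbf{b})$. The circulant graph $C_n(i_1,\ldots,i_k)$ is the (simple) graph with vertex set $\mathbb{Z}_n$ in which $r,s$ are adjacent iff $|r-s|_n\in\{i_1,\ldots,i_k\}$.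 The chromatic polynomial of a graph $G$ with vertex set $\{0,\ldots,n-1\}$ is $P(G;x):=\#\{\mathbf{b}\in\{0,\ldots,x-1\}^n : \mathbf{b}\text{ is a proper coloring of }G\}$. $P_i$ and $P_{i,j}$ denote the chromatic polynomials of $C_n(i)$ and $C_n(i,j)$, respectively. *)

(* Defs.v *)
From HB Require Import structures.
From mathcomp Require Import all_boot all_order all_algebra.
From mathcomp Require Import boolp reals.

Set Implicit Arguments.
Unset Strict Implicit.
Unset Printing Implicit Defensive.

Import Order.TTheory GRing.Theory Num.Theory.

Local Open Scope ring_scope.

(* |r|_n, as a natural number: for n > 0 both remainders are nonnegative, so
   the absolute values only serve to convert from int to nat. *)
Definition cnorm (n : nat) (r : int) : nat :=
  minn `|(r %% n)%Z|%N `|((- r) %% n)%Z|%N.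

(* A complete deterministic finite automaton (Q, L): the letters are mappings
   of the state set to itself. *)
Record automaton := Automaton {
  state : finType;
  letters : {set {ffun state -> state}}
}.

(* The leftmost letter of a word acts first. *)
Definition word_act (Q : finType) (w : seq {ffun Q -> Q}) (q : Q) : Q :=
  foldl (fun p (f : {ffun Q -> Q}) => f p) q w.

Definition synchronizes (A : automaton) : Prop :=
  exists2 w : seq {ffun state A -> state A},
    {subset w <= letters A} &
    exists q0 : state A, forall q : state A, word_act w q = q0.

Notation mappings n := {ffun 'I_n -> 'I_n}.

(* [ordS i] is (i + 1) mod n. *)
Definition shift (n : nat) : mappings n := [ffun i => ordS i].

Definition autA (n : nat) (b : mappings n) : automaton :=
  @Automaton 'I_n [set shift n; b].

Definition Dind (n i : nat) (b : mappings n) : bool :=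
  [exists k : 'I_n, exists l : 'I_n,
    (cnorm n (k%:Z - l%:Z) == i) && (cnorm n ((b k)%:Z - (b l)%:Z) == 0%N)].

Definition Dsum (n : nat) (b : mappings n) : nat :=
  (\sum_(1 <= i < n./2.+1) Dind i b)%N.

(* The adjacency relation of the circulant graph C_n(s); it is irreflexive,
   hence a simple graph, as soon as 0 is not in s. *)
Definition circulant (n : nat) (s : seq nat) : rel 'I_n :=
  fun r t => cnorm n (r%:Z - t%:Z) \in s.
Arguments circulant n s : clear implicits.

Definition chrompoly (n : nat) (e : rel 'I_n) (x : nat) : nat :=
  #|[set c : {ffun 'I_n -> 'I_x} |
      [forall r, forall t, e r t ==> (c r != c t)]]|.

Definition unif_prob (R : realType) (T : finType) (E : T -> Prop) : R :=
  #|[set b : T | `[< E b >]]|%:R / #|T|%:R.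

Definition unif_mean (R : realType) (T : finType) (X : T -> R) : R :=
  (\sum_(b : T) X b) / #|T|%:R.

Definition unif_var (R : realType) (T : finType) (X : T -> R) : R :=
  unif_mean (fun b => (X b - unif_mean X) ^+ 2).

Definition varD (R : realType) (n : nat) : R :=
  unif_var (fun b : mappings n => (Dsum b)%:R : R).

(* Main.v *)
Require Import Defs.
From HB Require Import structures.
From mathcomp Require Import all_boot all_order all_algebra.
From mathcomp Require Import boolp reals sequences exp.
From mathcomp Require Import ring lra zify.

(** Call [i] the distance of the pair [k, l] when [|k - l|_n = i], and write
[h] for [n./2] and [p] for [exp(-1)].  Rotations act transitively on the pairs
of a given distance, so all that matters about a pair is its distance.  If
every distance [i] in [1..h] is sent by [b], on at least one pair, to a
distance [d > 0] some pair of which [b] collapses, then every pair can be merged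
by a word rotate-[b]-rotate-[b], and the automaton synchronizes
([sync_criterion]).  By pigeonhole, if it does not synchronize, then for some
[i] the number [unhit i b] of distances in [1..(n-1)/2] that [b] never produces
from distance [i] satisfies [Dsum b <= unhit i b + 1] ([nonsync_Dsum]).

Both sides are controlled by the independence of the differences
[b (k + i) - b k].  The cycles of [k |-> k + i] number [g = gcd(i, n)]; opening
each of them leaves [n - g] differences that are independent and uniform, and
[n - g >= n / 2] ([card_chain], [walk_inj], [circ_prob]).

- A set of [s] distances in [1..(n-1)/2] consists of [2 s] residues, hence is
  avoided with probability at most [(1 - 2 s / n)^(n - g) <= p^s]: the
  indicators of unhit distances have joint moments bounded by those of
  independent Bernoulli([p]) variables.  Expanding [y^unhit] as a sum over
  subsets bounds the generating function by [(1 + (y - 1) p)^h], and the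
  Chernoff bound gives tails of [unhit i] beyond [h p + t] that are at most
  [exp(- t^2 / (2 n))] ([unhit_prob], [unhit_mgf], [unhit_tail]).
- Distance [i] has no collapsed pair with probability at most
  [(1 - 1/n)^(n - g) <= p exp(g / n)].  All but boundedly many [i] have
  [g <= n / K], so that the mean of [Dsum] is at least [h (1 - p) - o(h)]
  ([proper_prob], [card_large_gcd], [sum_proper_le]).

With [t = eps h - 1], failure to synchronize forces either
[unhit i b >= h p + t] for some [i], or [Dsum b <= h p + eps h], which lies below
the mean of [Dsum] by at least [t] because [1 - 2 p - 2 eps > 0].  The Chernoff
and Chebyshev inequalities bound these two events, and their sum is the claimed
bound ([sync_prob_ge]).

The variance formula is the expansion of the square of [h - Dsum], the sum over
[i] of the indicators that [b] is a proper colouring of [C_n(i)]: the product of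
the indicators for [i] and [j] is the indicator for [C_n(i, j)]. *)

Set Implicit Arguments.
Unset Strict Implicit.
Unset Printing Implicit Defensive.

Import Order.TTheory GRing.Theory Num.Theory.

Local Open Scope ring_scope.

(** * Mean and variance over a finite type *)

Section Mean.
Variables (R : realType) (T : finType).
Implicit Types X Y : T -> R.

Lemma unif_mean_sum (I : Type) (r : seq I) (P : pred I) (F : I -> T -> R) :
  unif_mean (fun b => \sum_(i <- r | P i) F i b)
  = \sum_(i <- r | P i) unif_mean (F i).
Proof. by rewrite /unif_mean exchange_big mulr_suml. Qed.

Lemma unif_meanD X Y :
  unif_mean (fun b => X b + Y b) = unif_mean X + unif_mean Y.
Proof. by rewrite /unif_mean big_split mulrDl. Qed.

Lemma unif_meanZ (c : R) X : unif_mean (fun b => c * X b) = c * unif_mean X.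
Proof. by rewrite /unif_mean -mulr_sumr mulrA. Qed.

Lemma eq_unif_mean X Y : X =1 Y -> unif_mean X = unif_mean Y.
Proof. by move=> eqXY; rewrite /unif_mean (eq_bigr Y). Qed.

Lemma le_unif_mean X Y : (forall b, X b <= Y b) -> unif_mean X <= unif_mean Y.
Proof.
by move=> leXY; rewrite /unif_mean ler_wpM2r ?invr_ge0 ?ler0n// ler_sum.
Qed.

Lemma le_unif_mean_bool (E F : pred T) : {subset E <= F} ->
  unif_mean (fun b => (E b)%:R : R) <= unif_mean (fun b => (F b)%:R : R).
Proof.
move=> EF; apply: le_unif_mean => b; rewrite ler_nat.
by case Eb: (E b) => //; rewrite [F b](EF b Eb).
Qed.

Lemma unif_mean_cst (c : R) : (0 < #|T|)%N -> unif_mean (fun _ : T => c) = c.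
Proof.
move=> T0; rewrite /unif_mean sumr_const -[c *+ _]mulr_natr mulfK//.
by rewrite pnatr_eq0 -lt0n.
Qed.

Lemma unif_mean_bool (E : pred T) :
  unif_mean (fun b => (E b)%:R : R) = #|[set b | E b]|%:R / #|T|%:R.
Proof.
rewrite /unif_mean -sum1_card natr_sum [in RHS]big_mkcond/=; congr (_ / _).
by apply: eq_bigr => b _; rewrite inE; case: (E b).
Qed.

Lemma unif_probE (E : T -> Prop) :
  unif_prob R E = unif_mean (fun b => (`[< E b >])%:R : R).
Proof. by rewrite unif_mean_bool. Qed.

Lemma unif_varE X : (0 < #|T|)%N ->
  unif_var X = unif_mean (fun b => X b ^+ 2) - unif_mean X ^+ 2.
Proof.
move=> T0; rewrite /unif_var; set m := unif_mean X.
rewrite (@eq_unif_mean _ (fun b => X b ^+ 2 + (- (2 * m) * X b + m ^+ 2)));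
  last by move=> b; ring.
by rewrite !unif_meanD unif_meanZ unif_mean_cst// -/m; ring.
Qed.

Lemma unif_var_cstB (c : R) X : (0 < #|T|)%N ->
  unif_var (fun b => c - X b) = unif_var X.
Proof.
move=> T0; rewrite /unif_var; apply: eq_unif_mean => b.
rewrite (@eq_unif_mean (fun b => c - X b) (fun b => c + -1 * X b)); last first.
  by move=> x; ring.
by rewrite unif_meanD unif_meanZ unif_mean_cst//; ring.
Qed.

End Mean.

(** * The variance of the number of collapsible distances *)

Lemma sum_square_sym (R : comNzRingType) (F : nat -> nat -> R) (h : nat) :
  (forall i j, F i j = F j i) ->
  \sum_(1 <= i < h.+1) \sum_(1 <= j < h.+1) F i j =
  \sum_(1 <= i < h.+1) F i i +
  2 * \sum_(1 <= i < h.+1) \sum_(i.+1 <= j < h.+1) F i j.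
Proof.
move=> Fsym; elim: h => [|h IH]; first by rewrite !big_geq// mulr0 addr0.
rewrite big_nat_recr//= [X in _ = X + _]big_nat_recr//=.
rewrite [X in _ = _ + 2 * X]big_nat_recr//= [X in _ = _ + 2 * (_ + X)]big_geq//.
rewrite (eq_big_nat _ _ (F2 := fun i => \sum_(1 <= j < h.+1) F i j + F i h.+1));
  last by move=> i _; rewrite big_nat_recr.
rewrite big_split/= IH [X in _ + X = _]big_nat_recr//=.
rewrite [X in 2 * (X + _)](eq_big_nat _ _
  (F2 := fun i => \sum_(i.+1 <= j < h.+1) F i j + F i h.+1)); last first.
  by move=> i /andP[_ ih]; rewrite big_nat_recr.
rewrite big_split/= (eq_bigr (F^~ h.+1) (fun i _ => Fsym h.+1 i)).
ring.
Qed.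

Lemma cnorm_eq0 n (k l : 'I_n) : (cnorm n (k%:Z - l%:Z) == 0%N) = (k == l).
Proof.
have n0 : (0 < n)%N by case: n k l => [[]|].
have nz : n%:Z != 0 by case: n n0 {k l}.
rewrite /cnorm -leqn0 geq_min !leqn0 !absz_eq0.
rewrite !(sameP eqP dvdz_mod0P) rpredN orbb -eqz_mod_dvd !modz_nat !modn_small//.
Qed.

Section Proper.
Variables (n : nat).

Definition proper_at i (b : mappings n) : bool :=
  [forall r, forall t, circulant n [:: i] r t ==> (b r != b t)].

Lemma DindN i (b : mappings n) : ~~ Dind i b = proper_at i b.
Proof.
rewrite negb_exists; apply: eq_forallb => k.
rewrite negb_exists; apply: eq_forallb => l.
by rewrite cnorm_eq0 negb_and /circulant inE implybE.
Qed.

Lemma chrompoly2 i j :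
  chrompoly (circulant n [:: i; j]) n
  = #|[set b | proper_at i b && proper_at j b]|.
Proof.
apply: eq_card => b; rewrite !inE.
apply/idP/andP => [/forallP H|[/forallP Hi /forallP Hj]].
  split; apply/forallP => r; apply/forallP => t; apply/implyP;
    move: (forallP (H r) t) => /implyP; rewrite /circulant !inE => H' e;
    by apply: H'; rewrite e ?orbT.
apply/forallP => r; apply/forallP => t; apply/implyP.
rewrite /circulant !inE => /orP[] e.
  by move: (forallP (Hi r) t) => /implyP; apply; rewrite /circulant inE.
by move: (forallP (Hj r) t) => /implyP; apply; rewrite /circulant inE.
Qed.

Lemma DsumE (R : realType) (b : mappings n) :
  (Dsum b)%:R = (n./2)%:R - \sum_(1 <= i < n./2.+1) (proper_at i b)%:R :> R.
Proof.
apply/esym/subr0_eq; rewrite -addrA -opprD -natr_sum -natrD -big_split/=.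
under eq_bigr => i _ do rewrite -DindN addn_negb.
by rewrite sum_nat_const_nat muln1 subn1 subrr.
Qed.

Lemma card_mappings : #|{: mappings n}| = (n ^ n)%N.
Proof. by rewrite card_ffun card_ord. Qed.

Lemma varD_formula (R : realType) : (0 < n)%N ->
     let P1 i : R := (chrompoly (circulant n [:: i]) n)%:R in
     let P2 i j : R := (chrompoly (circulant n [:: i; j]) n)%:R in
     varD R n =
       \sum_(1 <= i < n./2.+1)
          (P1 i / n%:R ^+ n - P1 i ^+ 2 / n%:R ^+ (2 * n))
       + 2 * \sum_(1 <= i < n./2.+1) \sum_(i.+1 <= j < n./2.+1)
          (P2 i j / n%:R ^+ n - P1 i * P1 j / n%:R ^+ (2 * n)).
Proof.
move=> n0 P1 P2.
have T0 : (0 < #|{: mappings n}|)%N by rewrite card_mappings expn_gt0 n0.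
have nn : n%:R ^+ n != 0 :> R by rewrite expf_neq0// pnatr_eq0 -lt0n.
pose z i (b : mappings n) : R := (proper_at i b)%:R.
have zz i j b : z i b * z j b = (proper_at i b && proper_at j b)%:R.
  by rewrite /z -natrM mulnb.
have Ez i : unif_mean (z i) = P1 i / n%:R ^+ n.
  by rewrite unif_mean_bool card_mappings natrX.
have Ezz i j : unif_mean (fun b => z i b * z j b) = P2 i j / n%:R ^+ n.
  under eq_unif_mean => b do rewrite zz.
  by rewrite unif_mean_bool card_mappings natrX -chrompoly2.
have -> : varD R n = unif_var (fun b => \sum_(1 <= i < n./2.+1) z i b).
  rewrite -[RHS](unif_var_cstB (n./2)%:R _ T0); congr unif_var.
  by apply/funext => b; exact: DsumE.
rewrite unif_varE// unif_mean_sum.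
under eq_unif_mean => b do rewrite expr2 mulr_suml.
under eq_unif_mean => b do under eq_bigr => i _ do rewrite mulr_sumr.
rewrite unif_mean_sum; under eq_bigr => i _ do rewrite unif_mean_sum.
rewrite expr2 mulr_suml; under [X in _ - X]eq_bigr => i _ do rewrite mulr_sumr.
rewrite -sumrB; under eq_bigr => i _ do rewrite -sumrB.
rewrite sum_square_sym; last first.
  move=> i j; rewrite mulrC; congr (_ - _).
  by apply: eq_unif_mean => b; rewrite mulrC.
have n2 : n%:R ^+ (2 * n) = n%:R ^+ n * n%:R ^+ n :> R.
  by rewrite mul2n -addnn exprD.
congr (_ + 2 * _); apply: eq_bigr => i _.
  rewrite Ez mulf_div -expr2 -n2 (@eq_unif_mean _ _ _ (z i)); last first.
    by move=> b; rewrite zz andbb.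
  by rewrite Ez.
apply: eq_bigr => j _.
by rewrite Ezz !Ez n2 mulf_div.
Qed.
End Proper.

(** * Distances and the synchronization criterion *)

Lemma modz_ordB n (k l : 'I_n.+1) :
  ((k%:Z - l%:Z) %% n.+1)%Z = Posz (k - l)%R.
Proof.
have -> : ((k - l)%R : nat) = ((k + (n.+1 - l)) %% n.+1)%N.
  by rewrite /= modnDmr.
have -> : k%:Z - l%:Z = (k + (n.+1 - l))%N%:Z - n.+1%:Z.
  by have := ltn_ord l; lia.
rewrite -modz_nat; apply/eqP; rewrite eqz_mod_dvd.
by rewrite addrAC subrr add0r rpredN dvdzz.
Qed.

(** [|x|_n] in the additive group of ['I_n.+1], where the two remainders
    in [cnorm] become [x] and [- x]. *)
Definition dist n (x : 'I_n.+1) : nat := minn x (- x)%R.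

Lemma cnormE n (k l : 'I_n.+1) : cnorm n.+1 (k%:Z - l%:Z) = dist (k - l).
Proof. by rewrite /cnorm opprB !modz_ordB /dist opprB. Qed.

Lemma distN n (x : 'I_n.+1) : dist (- x) = dist x.
Proof. by rewrite /dist opprK minnC. Qed.

Lemma dist_eq n (x y : 'I_n.+1) : dist x = dist y -> x = y \/ x = - y.
Proof.
have ordI (u v : 'I_n.+1) : u = v :> nat -> u = v by exact: val_inj.
rewrite /dist /minn; case: ifP => _; case: ifP => _ /ordI.
- by left.
- by right.
- by move=> <-; right; rewrite opprK.
- by move=> /oppr_inj; left.
Qed.

Lemma dist0 n : dist (0 : 'I_n.+1) = 0%N.
Proof. by rewrite /dist min0n. Qed.

Lemma dist_gt0 n (x : 'I_n.+1) : (0 < dist x)%N = (x != 0).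
Proof.
case: eqP => [->|/eqP x0]; first by rewrite dist0.
rewrite lt0n; apply/eqP; rewrite -(dist0 n) => /dist_eq[] e.
  by rewrite e eqxx in x0.
by rewrite e oppr0 eqxx in x0.
Qed.

Lemma val_oppr n (x : 'I_n.+1) : x != 0 -> (- x)%R = (n.+1 - x)%N :> nat.
Proof.
move=> x0; rewrite /= modn_small//.
have : (0 < x)%N by rewrite lt0n; apply: contra_neq x0 => e; apply: val_inj.
by have := ltn_ord x; lia.
Qed.

Lemma dist_le n (x : 'I_n.+1) : (dist x <= n.+1./2)%N.
Proof.
have [->|x0] := eqVneq x 0; first by rewrite dist0.
by rewrite /dist val_oppr// geq_min; lia.
Qed.

Lemma dist_inZp n i : (i <= n.+1./2)%N -> dist (inZp i : 'I_n.+1) = i.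
Proof.
move=> ih; case: (posnP i) => [->|i0].
  by rewrite (_ : inZp 0 = 0) ?dist0//; apply: val_inj; rewrite /= mod0n.
have ein : (inZp i : 'I_n.+1) = i :> nat by rewrite /= modn_small//; lia.
rewrite /dist val_oppr ?ein; first by apply/minn_idPl; lia.
by apply/eqP => /(congr1 val); rewrite /= modn_small/=; lia.
Qed.

(** States are merged one after the other: once a word has sent all of [s] to
    [r], a word merging [r] with the current image of [x] also handles [x]. *)
Lemma sync_of_pairs (Q : finType) (L : {set {ffun Q -> Q}}) (q0 : Q) :
  (forall p q, exists2 w : seq {ffun Q -> Q}, {subset w <= L} &
     word_act w p = word_act w q) ->
  synchronizes (Automaton L).
Proof.
move=> H.
suff [w wL [r Hr]] : exists2 w : seq {ffun Q -> Q}, {subset w <= L} &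
    exists r, forall q, q \in enum Q -> word_act w q = r.
  by exists w => //; exists r => q; apply: Hr; rewrite mem_enum.
elim: (enum Q) => [|x s [w wL [r Hr]]]; first by exists [::] => //; exists q0.
have [w' w'L e] := H r (word_act w x).
exists (w ++ w').
  by move=> f; rewrite mem_cat => /orP[/wL|/w'L].
exists (word_act w' r) => q; rewrite /word_act foldl_cat -!/(word_act _ _).
by rewrite inE => /predU1P[->//|/Hr->].
Qed.

Section Sync.
Variables (n : nat) (b : mappings n.+1).
Local Notation T := 'I_n.+1.

Lemma shift_word (c : T) : exists2 w : seq (mappings n.+1),
  {subset w <= letters (autA b)} & forall p, word_act w p = p + c.
Proof.
exists (nseq c (shift n.+1)).
  by move=> f /nseqP[-> _]; rewrite !inE eqxx.
move=> p; rewrite -{2}[c]valZpK; elim: (c : nat) p => [|m IH] p.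
  by apply: val_inj; rewrite /= mod0n addn0 modn_small.
rewrite /word_act /= -/(word_act _ _) IH ffunE.
by apply: val_inj; rewrite /= modnDml modnDmr modnDmr addSnnS.
Qed.

Definition hit (i d : nat) : bool :=
  [exists k : T, dist (b (k + inZp i) - b k) == d].

(** Rotations act transitively on the unordered pairs of a given distance. *)
Lemma dist_shift (p q k l : T) : dist (p - q) = dist (k - l) ->
  exists c, (p + c = k /\ q + c = l) \/ (p + c = l /\ q + c = k).
Proof.
have sw (x : T) : q + (x - p) = x - (p - q) by rewrite opprB addrC addrAC addrA.
case/dist_eq => e; [exists (k - p); left | exists (l - p); right];
  by rewrite sw e ?opprB [p + _]addrC subrK [_ + (_ - _)]addrC subrK.
Qed.

(** A pair at distance [i] is rotated onto a pair that [b] sends to distance [d];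
    its image is rotated onto a pair that [b] collapses. *)
Lemma sync_criterion :
  (forall i, (0 < i <= n.+1./2)%N ->
     exists d, [/\ (0 < d)%N, hit i d & Dind d b]) ->
  synchronizes (autA b).
Proof.
move=> H; apply: (@sync_of_pairs 'I_n.+1 _ ord0) => p q.
have [->|pq] := eqVneq p q; first by exists [::].
have i0 : (0 < dist (p - q)%R <= n.+1./2)%N by rewrite dist_gt0 subr_eq0 pq dist_le.
have [d [d0 /existsP[k /eqP kd] /existsP[k' /existsP[l']]]] := H _ i0.
rewrite cnormE cnorm_eq0 => /andP[/eqP kld /eqP bkl].
have [c Hc] : exists c, (p + c = k + inZp (dist (p - q)) /\ q + c = k) \/
   (p + c = k /\ q + c = k + inZp (dist (p - q))).
  apply: dist_shift; rewrite addrAC subrr add0r dist_inZp//.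
  by case/andP: i0.
have bd : dist (b (p + c) - b (q + c)) = dist (k' - l').
  by rewrite kld -kd; case: Hc => -[-> ->] //; rewrite -distN opprB.
have [c' Hc'] := dist_shift bd.
have [w wL Hw] := shift_word c.
have [w' w'L Hw'] := shift_word c'.
have bL : b \in letters (autA b) by rewrite !inE eqxx orbT.
exists (w ++ b :: rcons w' b).
  move=> f; rewrite mem_cat inE mem_rcons inE.
  by case/or4P=> [/wL|/eqP->|/eqP->|/w'L].
rewrite /word_act !foldl_cat /= !foldl_rcons -!/(word_act _ _) !Hw !Hw'.
by case: Hc' => -[-> ->].
Qed.
End Sync.

(** * Counting mappings with prescribed differences along chains *)

(** When the event [P] ignores the value at [v], that value is uniform and
    independent of [P] and of [b u].  The proof exchanges [b v] with a fresh
    value [t], an involution on pairs [(b, t)]. *)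
Lemma card_replace (V T : finType) (P : pred {ffun V -> T}) (v u : V)
    (A : T -> {set T}) (a : nat) :
  u != v -> (forall t, #|A t| <= a)%N ->
  (forall b c : {ffun V -> T},
     (forall w, w != v -> b w = c w) -> P b = P c) ->
  (#|[set b | P b & b v \in A (b u)]| * #|T| <= a * #|[set b | P b]|)%N.
Proof.
move=> uv leA Pv.
pose upd (b : {ffun V -> T}) t : {ffun V -> T} :=
  [ffun w => if w == v then t else b w].
have updv b t : upd b t v = t by rewrite ffunE eqxx.
have updu b t : upd b t u = b u by rewrite ffunE (negPf uv).
have Pupd b t : P (upd b t) = P b.
  by apply: Pv => w /negPf wv; rewrite ffunE wv.
pose X := setX [set b | P b & b v \in A (b u)] [set: T].
pose Y := [set bt : {ffun V -> T} * T | P bt.1 & bt.2 \in A (bt.1 u)].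
pose swap (bt : {ffun V -> T} * T) := (upd bt.1 bt.2, bt.1 v).
have swapK : involutive swap.
  move=> [b t]; rewrite /swap/= updv; congr (_, _).
  by apply/ffunP => w; rewrite !ffunE; case: eqP => [->|].
have -> : (#|[set b | P b & b v \in A (b u)]| * #|T|)%N = #|swap @: X|.
  by rewrite card_imset ?cardsX ?cardsT//; exact: inv_inj.
apply: (@leq_trans #|Y|).
  apply/subset_leq_card/subsetP => _ /imsetP[[b t] + ->].
  by rewrite !inE /= Pupd updu andbT.
rewrite -sum1_card (eq_bigl (fun bt => P bt.1 && (bt.2 \in A (bt.1 u)))); last first.
  by move=> bt; rewrite inE.
rewrite -(pair_big_dep P (fun b t => t \in A (b u)) (fun _ _ => 1%N))/=.
rewrite mulnC -sum_nat_const.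
rewrite [X in (_ <= X)%N](eq_bigl P); last by move=> b; rewrite inE.
by apply: leq_sum => b _; rewrite sum1_card.
Qed.

(** The sites [s 0, ..., s (g - 1)] are free and each later one is constrained
    only by the site [g] steps before it, so revealing the values in the order
    of [s] makes the [m] constraints independent. *)
Lemma card_chain (V T : finType) (s : nat -> V) (N g : nat)
    (A : T -> {set T}) (a : nat) :
  {in gtn N &, injective s} -> (0 < g)%N -> (forall t, #|A t| <= a)%N ->
  forall m, (g + m <= N)%N ->
  (#|[set b : {ffun V -> T} |
       [forall k : 'I_m, b (s (g + k)%N) \in A (b (s k))]]| * #|T| ^ m
   <= a ^ m * #|{: {ffun V -> T}}|)%N.
Proof.
move=> sI g0 leA; elim=> [|m IH] mN.
  by rewrite !expn0 muln1 mul1n max_card.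
pose P (b : {ffun V -> T}) :=
  [forall k : 'I_m, b (s (g + k)%N) \in A (b (s k))].
have sne i j : (i < j)%N -> (j <= g + m)%N -> s i != s j.
  move=> ij jm; apply/eqP => /sI e.
  have /e : i \in gtn N by rewrite inE; lia.
  have jN : j \in gtn N by rewrite inE; lia.
  by move=> /(_ jN); lia.
have Pv (b c : {ffun V -> T}) :
    (forall w, w != s (g + m)%N -> b w = c w) -> P b = P c.
  move=> bc; apply: eq_forallb => k; have := ltn_ord k => km.
  by rewrite !bc//; apply: sne; lia.
have := @card_replace _ _ P (s (g + m)%N) (s m) A a _ leA Pv.
move=> /(_ (sne _ _ _ _)) => H; have {}H := H ltac:(lia) ltac:(lia).
have eS : [set b : {ffun V -> T} |
       [forall k : 'I_m.+1, b (s (g + k)%N) \in A (b (s k))]]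
     = [set b | P b & b (s (g + m)%N) \in A (b (s m))].
  apply/setP => b; rewrite !inE; apply/forallP/andP => [H1|[/forallP H1 H2] k].
    split; last exact: (H1 ord_max).
    by apply/forallP => k; apply: (H1 (widen_ord (leqnSn m) k)).
  have := ltn_ord k; rewrite ltnS leq_eqVlt => /orP[/eqP->//|km].
  exact: (H1 (Ordinal km)).
rewrite eS expnS mulnA; apply: (@leq_trans (a * #|[set b | P b]| * #|T| ^ m)).
  by rewrite leq_mul2r H orbT.
rewrite -mulnA expnS -mulnA leq_mul2l IH ?orbT//; lia.
Qed.

(** * Unhit distances *)

Section Unhit.
Variables (n : nat).
Local Notation T := 'I_n.+1.

(** Only the distances [d] with [2 d < n.+1] are counted, so that each of them
    stands for exactly two residues, [d] and [- d]. *)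
Definition unhit (i : nat) (b : mappings n.+1) : nat :=
  (\sum_(d < n./2) ~~ hit b i d.+1)%N.

(** The summand [1] accounts for the distance [n.+1./2] when [n.+1] is even,
    which [unhit] ignores. *)
Lemma nonsync_Dsum (b : mappings n.+1) : ~ synchronizes (autA b) ->
  exists2 i, (0 < i <= n.+1./2)%N & (Dsum b <= unhit i b + 1)%N.
Proof.
move=> nsync; apply: contrapT => H; apply/nsync/sync_criterion => i ih.
apply: contrapT => Hd; apply: H; exists i => //.
have Dunhit (d : nat) : (Dind d.+1 b <= ~~ hit b i d.+1)%N.
  case: (boolP (Dind _ _)) => // D; case: (boolP (hit _ _ _)) => // hd.
  by case: Hd; exists d.+1.
rewrite /Dsum /unhit big_add1 succnK.
have [e|e] : n.+1./2 = n./2 \/ n.+1./2 = n./2.+1 by lia.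
  apply: leq_trans (leq_addr _ _); rewrite e big_mkord.
  by apply: leq_sum => d _; exact: Dunhit.
rewrite e big_nat_recr//= big_mkord leq_add// ?leq_b1//.
by apply: leq_sum => d _; exact: Dunhit.
Qed.

Variable i : nat.
Hypothesis ih : (0 < i <= n.+1./2)%N.
Let g := gcdn i n.+1.

(** Enumerates the group with all [g] cycles of [k |-> k + i] traversed in
    parallel: [g] steps of [walk] advance by [i] along a cycle. *)
Definition walk (j : nat) : T := inZp (j %% g + i * (j %/ g)).

Let g0 : (0 < g)%N. Proof. by rewrite gcdn_gt0 orbT. Qed.

Lemma walk_inj : {in gtn n.+1 &, injective walk}.
Proof.
have [gi gN] : (g %| i)%N /\ (g %| n.+1)%N by rewrite dvdn_gcdl dvdn_gcdr.
have key j j' : (j < n.+1)%N -> (j' < n.+1)%N -> (j' %/ g <= j %/ g)%N ->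
    walk j = walk j' -> j = j'.
  move=> jN j'N le /(congr1 val) /= e.
  have er : (j %% g = j' %% g)%N.
    have := congr1 (modn^~ g) e; rewrite !modn_dvdm//.
    move: gi => /dvdnP[i' ->].
    by rewrite !(mulnAC i' g) ![(_ %% g + _)%N]addnC !modnMDl !modn_mod.
  (* The walk determines the cycle; the position on it is recovered modulo the
     cycle length, since [i / g] is coprime to [n.+1 / g]. *)
  suff eq : (j %/ g = j' %/ g)%N by rewrite (divn_eq j g) er eq -divn_eq.
  move/eqP: e; rewrite er eqn_modDl eqn_mod_dvd ?leq_mul2l ?le ?orbT//.
  rewrite -mulnBr -{1}(divnK gN) -{1}(divnK gi) [(i %/ g * g)%N]mulnC -mulnA.
  rewrite [X in (X %| _)%N]mulnC dvdn_pmul2l// Gauss_dvdr; last first.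
    by rewrite /coprime -(eqn_pmul2r g0) mul1n muln_gcdl !divnK// gcdnC.
  have : (j %/ g < n.+1 %/ g)%N by rewrite ltn_divLR// divnK.
  move: (j %/ g)%N (j' %/ g)%N (n.+1 %/ g)%N le => p p' N le lt.
  move=> dv; apply/eqP; rewrite eqn_leq le andbT -subn_eq0.
  case: posnP => // pp'; have := dvdn_leq pp' dv.
  by rewrite leqNgt (leq_ltn_trans (leq_subr _ _) lt).
move=> j j'; rewrite !inE => jN j'N e.
by case: (leqP (j' %/ g) (j %/ g)) => [|/ltnW] le; [|apply/esym]; apply: key.
Qed.

Lemma walkD k : walk (g + k)%N = walk k + inZp i.
Proof.
rewrite /walk.
have -> : ((g + k) %/ g = (k %/ g).+1)%N by rewrite divnDl// divnn g0.
by apply: val_inj; rewrite /= modnDm modnDl mulnS addnCA addnC.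
Qed.

(** Of the [n.+1] cyclic constraints only [n.+1 - g] are kept, those that do not
    close a cycle. *)
Lemma card_circ (A : T -> {set T}) (a : nat) : (forall t, #|A t| <= a)%N ->
  (#|[set b : mappings n.+1 | [forall k : T, b (k + inZp i)%R \in A (b k)]]|
     * n.+1 ^ (n.+1 - g) <= a ^ (n.+1 - g) * n.+1 ^ n.+1)%N.
Proof.
move=> leA; have gN : (g <= n.+1)%N by rewrite dvdn_leq// dvdn_gcdr.
have := @card_chain _ T walk n.+1 g A a walk_inj g0 leA (n.+1 - g).
rewrite card_ord card_mappings subnKC// => /(_ (leqnn _)); apply: leq_trans.
rewrite leq_mul2r; apply/orP; right; apply/subset_leq_card/subsetP => b.
rewrite !inE => /forallP H; apply/forallP => k; rewrite walkD; exact: H.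
Qed.

Lemma gcd_le_half : (2 * g <= n.+1)%N.
Proof. by have /andP[i0 ?] := ih; have := dvdn_leq i0 (dvdn_gcdl i n.+1); lia. Qed.

Variable R : realType.

Lemma circ_prob (A : T -> {set T}) (c : nat) :
  (forall t, #|A t| + c <= n.+1)%N ->
  unif_mean (fun b : mappings n.+1 => [forall k : T, b (k + inZp i)%R \in A (b k)]%:R : R)
    <= expR (- (c%:R * (n.+1 - g)%:R / n.+1%:R)).
Proof.
move=> leA; have cN : (c <= n.+1)%N by apply: leq_trans (leA 0); rewrite leq_addl.
have leA' t : (#|A t| <= n.+1 - c)%N by have := leA t; lia.
have N0 : 0 < n.+1%:R :> R by rewrite ltr0n.
rewrite unif_mean_bool card_mappings ler_pdivrMr; last by rewrite natrX exprn_gt0.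
have N0' : 0 < n.+1%:R ^+ (n.+1 - g) :> R by rewrite exprn_gt0.
rewrite -(ler_pM2r N0').
have C := card_circ leA'; rewrite -(ler_nat R) natrM natrX natrM natrX in C.
apply: le_trans C _; rewrite mulrAC ler_wpM2r ?ler0n//.
have e : 1 - c%:R / n.+1%:R <= expR (- (c%:R / n.+1%:R)) :> R.
  exact: expR_ge1Dx.
rewrite mulrAC [_ * (n.+1 - g)%:R]mulrC -mulrN expRM_natl -exprMn.
rewrite lerXn2r ?nnegrE ?ler0n ?mulr_ge0 ?expR_ge0//.
rewrite natrB//; apply: le_trans (ler_wpM2r (ltW N0) e).
by rewrite mulrBl mul1r divfK// gt_eqF.
Qed.

Lemma proper_prob :
  unif_mean (fun b : mappings n.+1 => (proper_at i b)%:R : R)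
    <= expR (- ((n.+1 - g)%:R / n.+1%:R)).
Proof.
have := @circ_prob (fun t => [set~ t]) 1; rewrite mul1r => H.
apply: le_trans (H _); last by move=> t; rewrite cardsC1 card_ord addn1.
apply: le_unif_mean_bool => b /forallP Hb; apply/forallP => k; rewrite !inE.
have := forallP (Hb (k + inZp i)) k => /implyP; apply.
rewrite /circulant inE cnormE addrAC subrr add0r dist_inZp//.
by case/andP: ih.
Qed.

(** Negative dependence of the indicators of unhit distances, in the only form
    used: their joint moments are at most those of independent variables of
    mean [expR (- 1)]. *)
Lemma unhit_prob (f : {ffun 'I_(n./2) -> bool}) :
  unif_mean (fun b : mappings n.+1 => [forall d : 'I_(n./2), f d ==> ~~ hit b i d.+1]%:R : R)
    <= \prod_d (if f d then expR (-1) else 1).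
Proof.
rewrite -big_mkcond/= prodr_const -expRM_natl mulrN1.
set c := #|_|.
pose A (t : T) := [set u | [forall d : 'I_(n./2), f d ==> (dist (u - t)%R != d.+1)]].
have leA t : (#|A t| + c * 2 <= n.+1)%N.
  (* The residues excluded from [A t] contain [t + d] and [t - d] for each
     selected distance [d]. *)
  pose nb (de : 'I_(n./2) * bool) : T :=
    t + (if de.2 then inZp de.1.+1 else - inZp de.1.+1).
  have nbd de : dist (nb de - t) = de.1.+1.
    rewrite /nb addrAC subrr add0r; have := ltn_ord de.1.
    by case: de.2 => ?; rewrite ?distN dist_inZp//; lia.
  have nb_inj : injective nb.
    move=> [d e] [d' e'] H; have /= := nbd (d, e); rewrite H nbd /= => -[dd'].
    have {}dd' : d' = d by apply: val_inj.
    subst d'; congr (_, _); move: H => /addrI /=.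
    have := ltn_ord d => ltd.
    have x0 : (inZp d.+1 : T) != 0.
      by rewrite -dist_gt0 dist_inZp//; lia.
    have : (inZp d.+1 : T) <> - inZp d.+1.
      move=> /(congr1 (@nat_of_ord _)); rewrite val_oppr//= modn_small; lia.
    by move=> xNx; case: e; case: e' => // H; case: xNx;
      first [exact: H | exact: esym H].
  rewrite -[n.+1 in X in (_ <= X)%N](card_ord n.+1) -(cardsC (A t)) leq_add2l.
  have -> : (c * 2)%N = #|nb @: setX [set d | f d] [set: bool]|.
    by rewrite card_imset// cardsX cardsT card_bool cardsE.
  apply/subset_leq_card/subsetP => _ /imsetP[[d e] + ->].
  rewrite !inE /= andbT => fd; rewrite negb_forall; apply/existsP; exists d.
  by rewrite fd nbd eqxx.
apply: le_trans (_ : unif_mean (fun b : mappings n.+1 =>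
  [forall k : T, b (k + inZp i)%R \in A (b k)]%:R : R) <= _).
  apply: le_unif_mean_bool => b /forallP Hb.
  apply/forallP => k; rewrite inE; apply/forallP => d; apply/implyP => fd.
  have /implyP/(_ fd) := Hb d; rewrite negb_exists => /forallP; exact.
apply: (le_trans (circ_prob leA)); rewrite ler_expR lerN2.
rewrite ler_pdivlMr ?ltr0n// -!natrM ler_nat -mulnA leq_mul2l; apply/orP; right.
by have := gcd_le_half; lia.
Qed.

(** The right-hand side is the generating function of a binomial variable: both
    sides are expanded over the subsets [f] of distances and compared termwise
    by [unhit_prob]; the coefficients are nonnegative because [1 <= y]. *)
Lemma unhit_mgf (y : R) : 1 <= y ->
  unif_mean (fun b : mappings n.+1 => y ^+ unhit i b)
    <= (1 + (y - 1) * expR (-1)) ^+ n./2.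
Proof.
move=> y1; pose h := n./2.
have -> : unif_mean (fun b : mappings n.+1 => y ^+ unhit i b) =
    \sum_(f : {ffun 'I_h -> bool})
      unif_mean (fun b : mappings n.+1 => (\prod_d (if f d then y - 1 else 1)) *
        [forall d : 'I_(n./2), f d ==> ~~ hit b i d.+1]%:R).
  rewrite -unif_mean_sum; apply: eq_unif_mean => b.
  rewrite /unhit expr_sum.
  have -> : \prod_(d < h) y ^+ (~~ hit b i d.+1) = \prod_(d < h) \sum_(e : bool)
      (if e then (y - 1) * (~~ hit b i d.+1)%:R else 1).
    apply: eq_bigr => d _; rewrite big_bool /=.
    by case: (hit _ _ _); rewrite /= ?mulr0 ?add0r ?mulr1 ?subrK ?expr0 ?expr1.
  rewrite bigA_distr_bigA; apply: eq_bigr => f _.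
  case: forallP => [H|/forallP]; last first.
    rewrite negb_forall => /existsP[d]; rewrite negb_imply => /andP[fd hd].
    by rewrite mulr0 (bigD1 d)//= fd (negPf hd) mulr0 mul0r.
  rewrite mulr1; apply: eq_bigr => d _; have := H d.
  by case: (f d) => //= ->; rewrite mulr1.
have -> : (1 + (y - 1) * expR (-1)) ^+ n./2 = \sum_(f : {ffun 'I_h -> bool})
    (\prod_d (if f d then y - 1 else 1)) * \prod_d (if f d then expR (-1) else 1).
  rewrite -[n./2 in LHS]card_ord -prodr_const.
  under [LHS]eq_bigr => d _.
    have -> : 1 + (y - 1) * expR (-1) = \sum_(e : bool)
      (if e then y - 1 else 1) * (if e then expR (-1) else 1).
      by rewrite big_bool /= mulr1 addrC.
    over.
  rewrite bigA_distr_bigA; apply: eq_bigr => f _; exact: big_split.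
apply: ler_sum => f _; rewrite unif_meanZ ler_wpM2l ?unhit_prob//.
by apply: prodr_ge0 => d _; case: (f d); rewrite ?subr_ge0.
Qed.
End Unhit.

(** * Estimates *)

(** If [g = gcdn i n] exceeds [n / K], then [n / g] and [i / g] are both smaller
    than [K], and together they determine [i]. *)
Lemma card_large_gcd (n h K : nat) : (0 < n)%N -> (h <= n)%N ->
  (\sum_(1 <= i < h.+1) (n < K * gcdn i n) <= K * K)%N.
Proof.
move=> n0 hn; case: K => [|K]; first by rewrite big1.
rewrite big_add1 succnK big_mkord.
pose g (i : 'I_h) := gcdn i.+1 n.
pose S := [set i : 'I_h | n < K.+1 * g i]%N.
pose code (i : 'I_h) : 'I_K.+1 * 'I_K.+1 :=
  (inord (n %/ g i), inord (i.+1 %/ g i)).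
have g0 i : (0 < g i)%N by rewrite gcdn_gt0.
have codeI : {in S &, injective code}.
  move=> i j; rewrite !inE => iS jS [].
  have nlt k : (n < K.+1 * g k)%N -> (n %/ g k < K.+1)%N by rewrite ltn_divLR.
  have ilt k : (n < K.+1 * g k)%N -> (k.+1 %/ g k < K.+1)%N.
    by rewrite ltn_divLR//; apply: leq_ltn_trans; apply: leq_trans hn.
  move=> /(congr1 val); rewrite /= !inordK ?nlt// => en.
  move=> /(congr1 val); rewrite /= !inordK ?ilt// => ei.
  have eg : g i = g j.
    have e k : (n %/ g k * g k)%N = n by rewrite divnK// dvdn_gcdr.
    apply/eqP; rewrite -(@eqn_pmul2l (n %/ g i)).
      by rewrite {2}en !e.
    by rewrite divn_gt0// dvdn_leq// dvdn_gcdr.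
  apply: val_inj; apply: succn_inj.
  by rewrite -(divnK (dvdn_gcdl i.+1 n)) -/(g i) ei eg divnK// dvdn_gcdl.
rewrite (eq_bigr (fun i => if i \in S then 1 else 0)%N); last first.
  by move=> i _; rewrite inE; case: ltnP.
rewrite -big_mkcond sum1_card -(card_in_imset codeI).
by rewrite (leq_trans (max_card _))// card_prod card_ord.
Qed.

Section Estimates.
Variable R : realType.

(** From [expR (- x) >= 1 - x] and [1 / (1 - x) <= 1 + x + 2 x^2]. *)
Lemma expR_le_quad (x : R) : 0 <= x -> x <= 1 / 2 ->
  expR x <= 1 + x + 2 * x ^+ 2.
Proof.
move=> x0 x1; have := expR_ge1Dx (- x); rewrite expRN => H.
have E : expR x * (1 - x) <= 1.
  by rewrite -ler_pdivlMl ?expR_gt0// mulr1.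
have := expR_gt0 x; nra.
Qed.

Lemma expRN1_le : expR (- 1) <= 1 / 2 :> R.
Proof.
have := expR_ge1Dx (1 : R); rewrite expRN => H.
rewrite div1r lef_pV2 ?posrE ?expR_gt0//.
Qed.

(** An index with [g <= n / K] contributes at most [expR (- 1 + 1 / K)]; the
    at most [K * K] other ones are bounded by [1] each. *)
Lemma sum_proper_le (n K : nat) : (2 <= K)%N ->
  \sum_(1 <= i < n.+1./2.+1)
     unif_mean (fun b : mappings n.+1 => (proper_at i b)%:R : R)
  <= (K * K)%:R + (n.+1./2)%:R * (expR (- 1) + 2 / K%:R).
Proof.
move=> K2; set h := n.+1./2.
apply: (@le_trans _ _ (\sum_(1 <= i < h.+1)
   ((n.+1 < K * gcdn i n.+1)%:R + (expR (- 1) + 2 / K%:R)))); last first.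
  rewrite big_split/= sumr_const_nat subn1 -[(_ + _) *+ h]mulr_natl lerD2r.
  rewrite -natr_sum ler_nat.
  by apply: card_large_gcd => //; rewrite /h; lia.
have K0 : 0 < K%:R :> R by rewrite ltr0n; lia.
have N0 : 0 < n.+1%:R :> R by rewrite ltr0n.
rewrite big_nat [leRHS]big_nat; apply: ler_sum => i ih.
apply: (le_trans (proper_prob ih R)).
set g := gcdn i n.+1.
have gN : (g <= n.+1)%N by rewrite dvdn_leq// dvdn_gcdr.
case: ltnP => gK; last first.
  have -> : - ((n.+1 - g)%:R / n.+1%:R) = - 1 + g%:R / n.+1%:R :> R.
    by rewrite natrB// mulrBl divff ?gt_eqF// opprB addrC.
  have gK' : g%:R / n.+1%:R <= K%:R^-1 :> R.
    by rewrite ler_pdivrMr// ler_pdivlMl// -natrM ler_nat.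
  have iK : K%:R^-1 <= 1 / 2 :> R.
    by rewrite div1r lef_pV2 ?posrE// ler_nat.
  have iK0 : 0 <= K%:R^-1 :> R by rewrite invr_ge0 ltW.
  rewrite expRD add0r; have := expR_le_quad iK0 iK.
  have := expRN1_le; have := expR_gt0 (-1 : R).
  have : expR (g%:R / n.+1%:R) <= expR K%:R^-1 :> R by rewrite ler_expR.
  set p := expR (-1); set E := expR _; set F := expR _ => *; nra.
rewrite -[leLHS]addr0 lerD//; last first.
  by rewrite addr_ge0 ?expR_ge0// divr_ge0 ?ler0n.
by rewrite -[leRHS](@expR0 R) ler_expR oppr_le0 divr_ge0 ?ler0n.
Qed.

Lemma mean_Dsum (n : nat) :
  unif_mean (fun b : mappings n.+1 => (Dsum b)%:R : R) =
  (n.+1./2)%:R - \sum_(1 <= i < n.+1./2.+1)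
     unif_mean (fun b : mappings n.+1 => (proper_at i b)%:R : R).
Proof.
rewrite (eq_unif_mean (fun b => DsumE R b)).
rewrite (@eq_unif_mean _ _ _ (fun b => (n.+1./2)%:R +
  -1 * \sum_(1 <= i < n.+1./2.+1) (proper_at i b)%:R)).
  rewrite unif_meanD unif_meanZ unif_mean_sum unif_mean_cst ?mulN1r//.
  by rewrite card_mappings expn_gt0.
by move=> b; rewrite mulN1r.
Qed.

(** Chernoff bound for the event [unhit i b >= h p + t]: the integrand is at
    least [1] on it.  The rate [t / (2 h)] minimizes [- l t + h l^2], which
    bounds the exponent since [2 p <= 1]. *)
Lemma unhit_tail (n i : nat) (t : R) : (0 < i <= n.+1./2)%N ->
  0 <= t -> t <= (n.+1./2)%:R ->
  unif_mean (fun b : mappings n.+1 =>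
    expR (t / (2 * (n.+1./2)%:R) *
       ((unhit i b)%:R - (n.+1./2)%:R * expR (- 1) - t)))
  <= expR (- (1 / (2 * n.+1%:R) * t ^+ 2)).
Proof.
move=> ih t0 th; set h := n.+1./2 in ih th *; set p := expR (- 1) => /=.
have h0 : 0 < h%:R :> R by rewrite ltr0n; lia.
set l := t / (2 * h%:R).
have l0 : 0 <= l by rewrite divr_ge0// mulr_ge0 ?ler0n.
have l1 : l <= 1 / 2 by rewrite ler_pdivrMr ?mulr_gt0//; lra.
have tl : t = 2 * h%:R * l by rewrite /l mulrC divfK// mulf_neq0 ?gt_eqF.
rewrite (@eq_unif_mean _ _ _ (fun b => expR (- l * (h%:R * p + t)) *
   expR l ^+ unhit i b)); last first.
  by move=> b; rewrite -expRM_natl -expRD; congr expR; ring.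
rewrite unif_meanZ.
have y1 : 1 <= expR l by rewrite -expR0 ler_expR.
apply: (le_trans (ler_wpM2l (expR_ge0 _) (unhit_mgf ih y1))).
have p0 : 0 < p := expR_gt0 _.
have ph : p <= 1 / 2 := expRN1_le.
have hn : (n./2 <= h)%N by rewrite /h; lia.
have B : (1 + (expR l - 1) * p) ^+ n./2 <= expR (h%:R * (p * l + l ^+ 2)).
  rewrite expRM_natl.
  have y0 : 1 <= 1 + (expR l - 1) * p.
    by rewrite lerDl mulr_ge0 ?subr_ge0// ltW.
  apply: le_trans (ler_weXn2l y0 hn) _.
  rewrite lerXn2r ?nnegrE ?expR_ge0 ?(le_trans ler01)//.
  apply: le_trans (expR_ge1Dx _); rewrite lerD2l.
  by have := expR_le_quad l0 l1; nra.
apply: (le_trans (ler_wpM2l (expR_ge0 _) B)).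
rewrite -expRD ler_expR.
have hN : 2 * h%:R <= n.+1%:R :> R by rewrite -natrM ler_nat mul2n -geq_half_double.
have N0 : 0 < n.+1%:R :> R by rewrite ltr0n.
have -> : - l * (h%:R * p + t) + h%:R * (p * l + l ^+ 2) = - (h%:R * l ^+ 2).
  by rewrite {1}tl; ring.
rewrite lerN2 tl mulrAC ler_pdivrMr ?mulr_gt0// mul1r.
have : 0 <= h%:R * l ^+ 2 by rewrite mulr_ge0 ?sqr_ge0// ltW.
nra.
Qed.

End Estimates.

(** Instead of a union of events, a pointwise inequality is averaged: off the
    synchronizing mappings either the Chebyshev quotient or one of the Chernoff
    integrands is at least [1]. *)
Lemma sync_prob_ge (R : realType) (n : nat) (eps : R) (t := eps * (n.+1./2)%:R - 1) :
  0 < t -> t <= (n.+1./2)%:R ->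
  (n.+1./2)%:R * (expR (- 1) + 2 * eps) - 1
    <= unif_mean (fun b : mappings n.+1 => (Dsum b)%:R : R) ->
  1 - (n.+1./2)%:R * expR (- (1 / (2 * n.+1%:R) * t ^+ 2)) - varD R n.+1 / t ^+ 2
  <= unif_prob R (fun b : mappings n.+1 => synchronizes (autA b)).
Proof.
set h := n.+1./2 in t *; set mu := unif_mean _ => t0 th hmu.
pose tail i (b : mappings n.+1) : R :=
  expR (t / (2 * h%:R) * ((unhit i b)%:R - h%:R * expR (- 1) - t)).
have t20 : 0 < t ^+ 2 by rewrite exprn_gt0.
have pointwise (b : mappings n.+1) : 1 <= (`[< synchronizes (autA b) >])%:R +
    ((t ^+ 2)^-1 * ((Dsum b)%:R - mu) ^+ 2 + \sum_(1 <= i < h.+1) tail i b).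
  have tail0 i : 0 <= tail i b by exact: expR_ge0.
  have sum0 : 0 <= \sum_(1 <= i < h.+1) tail i b by apply: sumr_ge0.
  have sq0 : 0 <= (t ^+ 2)^-1 * ((Dsum b)%:R - mu) ^+ 2.
    by rewrite mulr_ge0 ?sqr_ge0// invr_ge0 ltW.
  case: asboolP => [_|nsync]; first by rewrite lerDl addr_ge0.
  rewrite add0r; have [i ih DU] := nonsync_Dsum nsync.
  have [Ui|Ui] := lerP (h%:R * expR (- 1) + t) (unhit i b)%:R.
    have tail1 : 1 <= tail i b.
      rewrite -expR0 ler_expR mulr_ge0//; last by lra.
      by rewrite divr_ge0 ?mulr_ge0 ?ler0n// ltW.
    rewrite (le_trans tail1)// (bigD1_seq i) ?iota_uniq//=; last first.
      by rewrite mem_index_iota ltnS.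
    by rewrite ler_wpDl // lerDl sumr_ge0.
  apply: (@le_trans _ _ ((t ^+ 2)^-1 * ((Dsum b)%:R - mu) ^+ 2)); last first.
    by rewrite lerDl.
  rewrite mulrC ler_pdivlMr// mul1r -[leRHS]sqrrN opprB.
  have : (Dsum b)%:R <= (unhit i b)%:R + 1 :> R by rewrite -(natrD _ _ 1) ler_nat.
  move=> DU'; have tmu : t <= mu - (Dsum b)%:R by rewrite /t in t0 Ui *; lra.
  by rewrite lerXn2r ?nnegrE ?(ltW t0) ?(le_trans (ltW t0) tmu).
have := le_unif_mean pointwise.
rewrite unif_mean_cst; last by rewrite card_mappings expn_gt0.
rewrite !unif_meanD unif_meanZ -unif_probE unif_mean_sum -/(unif_var _) -/(varD R n.+1).
have : \sum_(1 <= i < h.+1) unif_mean (tail i) <=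
   h%:R * expR (- (1 / (2 * n.+1%:R) * t ^+ 2)).
  rewrite mulr_natl -[X in _ *+ X](subn1 h.+1) -sumr_const_nat !big_nat.
  by apply: ler_sum => i ih; apply: unhit_tail => //; rewrite ltW.
rewrite [varD _ _ / _]mulrC; lra.
Qed.

Theorem theorem24 (R : realType) (eps : R)
  (eps_gt0 : 0 < eps) (eps_lt : eps < 1 / 2 - expR (- 1)) :
  (exists n_eps : nat, forall n : nat, (0 < n)%N -> (n_eps <= n)%N ->
     unif_prob R (fun b : mappings n => synchronizes (autA b)) >=
       1 - (n./2)%:R * expR (- (1 / (2 * n%:R) * (eps * (n./2)%:R - 1) ^+ 2))
         - varD R n / (eps * (n./2)%:R - 1) ^+ 2)
  /\
  (forall n : nat, (0 < n)%N ->
     let P1 i : R := (chrompoly (circulant n [:: i]) n)%:R in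
     let P2 i j : R := (chrompoly (circulant n [:: i; j]) n)%:R in
     varD R n =
       \sum_(1 <= i < n./2.+1)
          (P1 i / n%:R ^+ n - P1 i ^+ 2 / n%:R ^+ (2 * n))
       + 2 * \sum_(1 <= i < n./2.+1) \sum_(i.+1 <= j < n./2.+1)
          (P2 i j / n%:R ^+ n - P1 i * P1 j / n%:R ^+ (2 * n))).
Proof.
split; last by move=> n n0; exact: varD_formula.
have p0 : 0 < expR (- 1) :> R := expR_gt0 _.
pose gam : R := 1 - 2 * expR (- 1) - 2 * eps.
have gam0 : 0 < gam by rewrite /gam; lra.
(* [K] makes the contribution [2 h / K] of the cycle lengths at most half of
   the gap [gam * h], [H] makes [K * K] at most the other
   half and [eps * h - 1] positive. *)
pose K := (Num.bound (4 / gam)).+2.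
have K0 : 0 < K%:R :> R by rewrite ltr0n.
have Kgam : 2 / K%:R <= gam / 2.
  have : 4 / gam < K%:R.
    apply: lt_le_trans (archi_boundP _) _; first by rewrite divr_ge0 ?ltW.
    by rewrite ler_nat /K; lia.
  rewrite ltr_pdivrMr// ler_pdivrMr//; lra.
pose H := Num.bound (2 / eps + 2 * (K * K)%:R / gam).
have A0 : 0 <= 2 / eps by rewrite divr_ge0// ltW.
have B0 : 0 <= 2 * (K * K)%:R / gam by rewrite divr_ge0 ?mulr_ge0 ?ler0n ?(ltW gam0).
have HP : 2 / eps + 2 * (K * K)%:R / gam < H%:R.
  by apply: archi_boundP; rewrite addr_ge0.
exists H.*2 => -[//|n] _; rewrite -geq_half_double; set h := n.+1./2 => Hh.
have {}HP : 2 / eps + 2 * (K * K)%:R / gam < h%:R.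
  by apply: lt_le_trans HP _; rewrite ler_nat.
have h1 : 2 < eps * h%:R by rewrite -ltr_pdivrMl// mulrC; lra.
have h2 : 2 * (K * K)%:R < h%:R * gam by rewrite -ltr_pdivrMr//; lra.
have h0 : 0 <= h%:R :> R by [].
apply: sync_prob_ge; rewrite -/h; [lra|nra|].
rewrite mean_Dsum -/h.
have := @sum_proper_le R n K isT; rewrite -/h.
have : h%:R * (2 / K%:R) <= h%:R * (gam / 2) by rewrite ler_wpM2l.
rewrite /gam in h2 *; set S := \sum_(_ <= _ < _) _; lra.
Qed.
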